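(* Consider the infinite-horizon dynamic multi-agent system described in the context, and suppose Assumption B holds and $(\mathbf A_i,\mathbf B_i)$ is controllable for every $i\in\mathcal V$. Let $\mathcal X_0\subseteq\mathbb R^{nd}$ be the set of feasible initial conditions. Then there exists a set $\mathbb X_0\subseteq\mathcal X_0$ such that (i) $\mathbb X_0$ has nonempty interior and contains the origin in its interior; and (ii) for every $\mathbf x(0)\in\mathbb X_0$, every optimal solution $(\mathbf U^\ast,\mathbf E^\ast)$ of the infinite-horizon social welfare maximization problem for $\mathbf x(0)$, together with the zero price sequence $\lambda^\ast_t=0$ for all $t\ge0$, forms an infinite-horizon competitive equilibrium.
   Context: Infinite-horizon dynamic multi-agent system: $n$ agents $\mathcal V=\{1,\dots,n\}$, time set $\mathcal T=\{0,1,2,\dots\}$. Agent $i$ has state $\mathbf x_i(t)\in\mathbb R^d$, input $\mathbf u_i(t)\in\mathbb R^m$, dynamics $\mathbf x_i(t+1)=\mathbf A_i\mathbf x_i(t)+\mathbf B_i\mathbf u_i(t)$, utility $f_i:\mathbb R^d\times\mathbb R^m\to\mathbb R$, resource consumption $h_i:\mathbb R^m\to\mathbb R$, excess resource $a_i(t)\in\mathbb R$, traded resource $e_i(t)\in\mathbb R$; $C(t)=\sum_ia_i(t)$; $\mathbf x(t)=(\mathbf x_1(t),\dots,\mathbf x_n(t))\in\mathbb R^{nd}$ with given $\mathbf x(0)$; $\mathbf U_i,\mathbf E_i$ denote the sequences $(\mathbf u_i(t))_{t\ge0}$, $(e_i(t))_{t\ge0}$, and $\mathbf U,\mathbf E$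 their collections over all agents. Assumption B: (i) each $f_i$ is concave and negative definite, i.e. $f_i(\mathbf 0,\mathbf 0)=0$ and $f_i(\mathbf x,\mathbf u)<0$ for $(\mathbf x,\mathbf u)\ne(\mathbf 0,\mathbf 0)$; (ii) each $h_i$ is non-negative and convex; (iii) $h_i(\mathbf 0)=0$; (iv) there is $C>0$ with $C(t)\ge C$ for all $t\ge0$. (Under (i) all series $\sum_t f_i$ converge in $[-\infty,0]$.) An infinite-horizon competitive equilibrium for $\mathbf x(0)$ is a triple $(\boldsymbol\lambda^\ast,\mathbf U^\ast,\mathbf E^\ast)$, $\boldsymbol\lambda^\ast=(\lambda^\ast_t)_{t\ge0}$, such that (i) for each $i$, $(\mathbf U_i^\ast,\mathbf E_i^\ast)$ attains a finite maximum of $\sum_{t=0}^\infty[f_i(\mathbf x_i(t),\mathbf u_i(t))+\lambda^\ast_te_i(t)]$ subject to the dynamics and $e_i(t)\le a_i(t)-h_i(\mathbf u_i(t))$ for all $t$; (ii) $\sum_{i=1}^ne_i^\ast(t)=0$ for all $t$. The infinite-horizon social welfare maximization problem for $\mathbf x(0)$: maximize $\sum_{i=1}^n\sum_{t=0}^\infty f_i(\mathbf x_i(t),\mathbf u_i(t))$ over $(\mathbf U,\mathbf E)$ subject to the dynamics, $e_i(t)\le a_i(t)-h_i(\mathbf u_i(t))$ and $\sum_{i=1}^ne_i(t)=0$ for all $t\ge0$. The set of feasible initial conditions $\mathcal X_0$ consists of those $\mathbf x(0)$ for which this problem has an admissible $(\mathbf U,\mathbf E)$ and finite optimal value. *)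

(* Defs.v *)
From HB Require Import structures.
From mathcomp Require Import all_boot all_order all_algebra.
From mathcomp Require Import all_classical all_reals all_analysis.
Set Implicit Arguments. Unset Strict Implicit. Unset Printing Implicit Defensive.
Import Order.TTheory GRing.Theory Num.Theory.
Import numFieldNormedType.Exports.
Local Open Scope ring_scope.
Local Open Scope classical_set_scope.

Section MAS.
Variables (R : realType) (n d m : nat).

(* Kalman rank condition: (A,B) controllable iff rank [B AB ... A^(d-1)B] = d. *)
Definition controllable (A : 'M[R]_d) (B : 'M[R]_(d, m)) : Prop :=
  \rank (\mxrow_(k < d) (A ^+ k *m B)) = d.

Definition concave_fun (f : 'cV[R]_d -> 'cV[R]_m -> R) : Prop :=
  forall (x1 x2 : 'cV[R]_d) (u1 u2 : 'cV[R]_m) (l : R), 0 <= l -> l <= 1 ->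
    l * f x1 u1 + (1 - l) * f x2 u2 <= f (l *: x1 + (1 - l) *: x2) (l *: u1 + (1 - l) *: u2).

Definition negative_definite (f : 'cV[R]_d -> 'cV[R]_m -> R) : Prop :=
  f 0 0 = 0 /\ forall x u, (x, u) != (0, 0) -> f x u < 0.

Definition convex_fun (h : 'cV[R]_m -> R) : Prop :=
  forall (u1 u2 : 'cV[R]_m) (l : R), 0 <= l -> l <= 1 ->
    h (l *: u1 + (1 - l) *: u2) <= l * h u1 + (1 - l) * h u2.

Fixpoint traj (A : 'M[R]_d) (B : 'M[R]_(d, m)) (x0 : 'cV[R]_d)
  (u : nat -> 'cV[R]_m) (t : nat) : 'cV[R]_d :=
  match t with
  | O => x0
  | S t' => A *m traj A B x0 u t' + B *m u t'
  end.

Variables (A : 'I_n -> 'M[R]_d) (B : 'I_n -> 'M[R]_(d, m))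
  (f : 'I_n -> 'cV[R]_d -> 'cV[R]_m -> R) (h : 'I_n -> 'cV[R]_m -> R)
  (a : 'I_n -> nat -> R).

Definition assumptionB : Prop :=
  (forall i, concave_fun (f i) /\ negative_definite (f i)) /\
  (forall i, (forall u, 0 <= h i u) /\ convex_fun (h i)) /\
  (forall i, h i 0 = 0) /\
  (exists C : R, 0 < C /\ forall t, C <= \sum_(i < n) a i t).

(* The aggregate initial state x(0) in R^{nd}: column i is x_i(0). *)
Definition xi0 (x0 : 'M[R]_(d, n)) (i : 'I_n) : 'cV[R]_d := col i x0.

Definition admissible_i (i : 'I_n) (u : nat -> 'cV[R]_m) (e : nat -> R) : Prop :=
  forall t, e t <= a i t - h i (u t).

Definition agent_value (i : 'I_n) (x0 : 'M[R]_(d, n)) (lam : nat -> R)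
  (u : nat -> 'cV[R]_m) (e : nat -> R) : \bar R :=
  (\sum_(t <oo) (f i (traj (A i) (B i) (xi0 x0 i) u t) (u t) + lam t * e t)%:E)%E.

Definition competitive_equilibrium (x0 : 'M[R]_(d, n)) (lam : nat -> R)
  (U : 'I_n -> nat -> 'cV[R]_m) (E : 'I_n -> nat -> R) : Prop :=
  (forall i,
     admissible_i i (U i) (E i) /\
     agent_value i x0 lam (U i) (E i) \is a fin_num /\
     (forall u e, admissible_i i u e ->
        (agent_value i x0 lam u e <= agent_value i x0 lam (U i) (E i))%E)) /\
  (forall t, \sum_(i < n) E i t = 0).

Definition sw_admissible (U : 'I_n -> nat -> 'cV[R]_m) (E : 'I_n -> nat -> R) : Prop :=
  (forall i, admissible_i i (U i) (E i)) /\ (forall t, \sum_(i < n) E i t = 0).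

Definition social_welfare (x0 : 'M[R]_(d, n))
  (U : 'I_n -> nat -> 'cV[R]_m) : \bar R :=
  (\sum_(i < n) \sum_(t <oo) (f i (traj (A i) (B i) (xi0 x0 i) (U i) t) (U i t))%:E)%E.

Definition sw_value (x0 : 'M[R]_(d, n)) : \bar R :=
  ereal_sup [set social_welfare x0 U | U in
             [set U | exists E, sw_admissible U E]].

Definition sw_optimal (x0 : 'M[R]_(d, n))
  (U : 'I_n -> nat -> 'cV[R]_m) (E : 'I_n -> nat -> R) : Prop :=
  sw_admissible U E /\
  forall U' E', sw_admissible U' E' ->
    (social_welfare x0 U' <= social_welfare x0 U)%E.

Definition feasible_initial_conditions : set 'M[R]_(d, n) :=
  [set x0 | (exists U E, sw_admissible U E) /\ sw_value x0 \is a fin_num].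

End MAS.

(* Main.v *)
(** A concave negative definite utility is coercive: [f x u >= - e] with [e]
    small forces [u] to be small, hence [h u <= C / (n + 1)]. By controllability
    every small initial state can be driven to the origin in [d] steps by small
    inputs, so near the origin the optimal welfare is at least [- e]. As all
    stage utilities are nonpositive, this bound is inherited by every stage
    utility of an optimal solution, and of any unilateral improvement of an
    agent's unconstrained value. Along both, the total consumption stays below
    [C], so such an improvement would be feasible for the welfare problem and
    contradict optimality: each agent already attains its maximum at zero price. *)
Require Import Defs.
From HB Require Import structures.
From mathcomp Require Import all_boot all_order all_algebra.
From mathcomp Require Import all_classical all_reals all_analysis.
From mathcomp Require Import lra zify.
Import Order.TTheory GRing.Theory Num.Theory.
Import numFieldNormedType.Exports.
Local Open Scope ring_scope.
Local Open Scope classical_set_scope.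

(** * Convex functions: smallness near the origin, continuity, coercivity *)

Definition convex_lmod {R : realType} {V : lmodType R} (g : V -> R) : Prop :=
  forall (x y : V) (l : R), 0 <= l -> l <= 1 ->
    g (l *: x + (1 - l) *: y) <= l * g x + (1 - l) * g y.

Lemma convex_midpoint {R : realType} {V : lmodType R} (g : V -> R) (x y : V) :
  convex_lmod g -> g (x + y) <= 2^-1 * (g (2 *: x) + g (2 *: y)).
Proof.
move=> cg; have h1 : (1 : R) - 2^-1 = 2^-1 by lra.
have := cg (2 *: x) (2 *: y) 2^-1; rewrite h1 !scalerA mulVf ?pnatr_eq0//.
rewrite !scale1r mulrDr; apply; lra.
Qed.

Lemma convex_scale_le {R : realType} {V : lmodType R} (g : V -> R) (x : V) (l : R) :
  convex_lmod g -> g 0 = 0 -> 0 <= l -> l <= 1 -> g (l *: x) <= l * g x.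
Proof.
move=> cg g0 l0 l1; have := cg x 0 l l0 l1.
by rewrite g0 scaler0 mulr0 !addr0.
Qed.

(** Shrinking [v] or [- v], according to the sign of [c], bounds [g (c *: v)] by the absolute value
    of [c] times a constant. *)
Lemma convex_near0_line {R : realType} {V : lmodType R} (g : V -> R) (v : V) (e : R) :
  convex_lmod g -> g 0 = 0 -> 0 < e -> \forall c \near (0 : R), g (c *: v) <= e.
Proof.
move=> cg g0 e0.
pose M := `|g v| + `|g (- v)| + 1.
have M0 : 0 < M by rewrite /M ltr_wpDl ?addr_ge0.
have p0 : 0 < Num.min 1 (e / M) by rewrite lt_min ltr01 divr_gt0.
apply/nbhs_norm0P; exists (Num.min 1 (e / M)) => //= c /=.
rewrite lt_min => /andP[c1 cM].
have cMe : `|c| * M <= e by rewrite -ler_pdivlMr// ltW.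
apply: le_trans cMe.
have [c0|c0] := leP 0 c.
  have := convex_scale_le g v `|c| cg g0 (normr_ge0 _) (ltW c1).
  rewrite {1}ger0_norm// => /le_trans; apply.
  apply: ler_wpM2l => //; have := ler_norm (g v); have := normr_ge0 (g (- v)).
  rewrite /M; lra.
have := convex_scale_le g (- v) `|c| cg g0 (normr_ge0 _) (ltW c1).
rewrite {1}ltr0_norm// scaleNr scalerN opprK => /le_trans; apply.
apply: ler_wpM2l => //; have := ler_norm (g (- v)); have := normr_ge0 (g v).
rewrite /M; lra.
Qed.

(** Coordinates are split off one at a time by midpoint convexity. This doubles both summands, so
    the induction hypothesis is pulled back along [z |-> 2 *: z]. *)
Lemma convex_near0 {R : realType} {p q : nat} (g : 'M[R]_(p, q) -> R) (e : R) :
  convex_lmod g -> g 0 = 0 -> 0 < e -> \forall z \near (0 : 'M[R]_(p, q)), g z <= e.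
Proof.
move=> cg g0.
move=> e0.
have H (s : seq ('I_p * 'I_q)) : forall e' : R, 0 < e' ->
    \forall z \near (0 : 'M[R]_(p, q)),
      g (\sum_(ij <- s) (z : 'M[R]_(p, q)) ij.1 ij.2 *: delta_mx ij.1 ij.2) <= e'.
  move=> {e e0}.
  elim: s => [|[i j] s IH] e e0.
    by near=> z; rewrite big_nil g0 ltW.
  have H1 : \forall z \near (0 : 'M[R]_(p, q)),
      g ((z : 'M[R]_(p, q)) i j *: (2 *: delta_mx i j)) <= e.
    have := @coord_continuous R p q i j 0; rewrite /continuous_at mxE => zij.
    apply: (zij [set c | g (c *: (2 *: delta_mx i j)) <= e]).
    exact: convex_near0_line.
  have H2 : \forall z \near (0 : 'M[R]_(p, q)),
      g (\sum_(ij <- s) (2 *: z : 'M[R]_(p, q)) ij.1 ij.2 *: delta_mx ij.1 ij.2) <= e.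
    have := @scaler_continuous R 'M[R]_(p, q) 2 0.
    rewrite /continuous_at scaler0 => z2; exact: (z2 _ (IH e e0)).
  near=> z.
  rewrite big_cons /=; apply: le_trans (convex_midpoint _ _ _ cg) _.
  have -> : 2 *: (\sum_(ij <- s) z ij.1 ij.2 *: delta_mx ij.1 ij.2) =
      \sum_(ij <- s) (2 *: z) ij.1 ij.2 *: delta_mx ij.1 ij.2 :> 'M[R]_(p, q).
    by rewrite scaler_sumr; apply: eq_bigr => k _; rewrite mxE scalerA.
  have h1 : g (2 *: (z i j *: delta_mx i j)) <= e.
    by rewrite scalerA mulrC -scalerA; near: z.
  have h2 : g (\sum_(ij <- s) (2 *: z) ij.1 ij.2 *: delta_mx ij.1 ij.2) <= e by near: z.
  lra.
have := H (index_enum _) e e0.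
apply: filterS => z; rewrite [in X in _ -> X](matrix_sum_delta z) pair_bigA /=; exact.
Unshelve. all: by end_near. Qed.

(** The increment [k] at [z0] is convex and vanishes at 0, hence is small from above near 0. The
    lower bound comes from [0 = k 0 <= (k z + k (- z)) / 2]. *)
Lemma convex_continuous {R : realType} {p q : nat} (g : 'M[R]_(p, q) -> R) :
  convex_lmod g -> continuous g.
Proof.
move=> cg z0; apply/(@cvgrPdist_le _ _ _ (nbhs z0)) => e e0.
apply/(@nbhs0P _ 'M[R]_(p, q) [set z | `|g z0 - g z| <= e]).
pose k z := g (z0 + z) - g z0.
have ck : convex_lmod k.
  move=> x y l l0 l1; rewrite /k.
  have -> : z0 + (l *: x + (1 - l) *: y) = l *: (z0 + x) + (1 - l) *: (z0 + y).
    by rewrite !scalerDr addrACA -scalerDl subrKC scale1r.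
  have := cg (z0 + x) (z0 + y) l l0 l1; lra.
have k0 : k 0 = 0 by rewrite /k addr0 subrr.
have kN : \forall z \near (0 : 'M[R]_(p, q)), k (- z) <= e.
  have := @opp_continuous 'M[R]_(p, q) 0; rewrite /continuous_at oppr0 => zN.
  exact: (zN _ (convex_near0 k e ck k0 e0)).
near=> z.
have h1 : k z <= e by near: z; exact: convex_near0.
have h2 : k (- z) <= e by near: z.
have := ck z (- z) 2^-1.
have h3 : (1 : R) - 2^-1 = 2^-1 by lra.
rewrite h3 -scalerDr subrr scaler0 k0 => h4.
rewrite /= distrC ler_norml.
have {}h4 : 0 <= 2^-1 * k z + 2^-1 * k (- z) by apply: h4; lra.
rewrite /k in h1 h2 h4; apply/andP; split; lra.
Unshelve. all: by end_near. Qed.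

(** On the compact sphere of radius [r], [g] has a positive minimum. Scaling a point outside the
    ball back to the sphere does not increase [g], so [c] below this minimum suffices. *)
Lemma convex_coercive {R : realType} {p : nat} (g : 'rV[R]_p -> R) (r : R) :
  convex_lmod g -> g 0 = 0 -> (forall z, z != 0 -> 0 < g z) -> 0 < r ->
  \forall c \near 0^'+, forall z, g z <= c -> `|z| < r.
Proof.
move=> cg g0 gp r0.
pose K : set 'rV[R]_p := [set z | `|z| = r].
have normK z : r <= `|z| -> K ((r / `|z|) *: z).
  move=> rz; have z0 : 0 < `|z| by exact: lt_le_trans rz.
  by rewrite /K/= normrZ normrM normfV normr_id (gtr0_norm r0) divfK ?gt_eqF.
(* An empty sphere, as for [p = 0], means that no vector has norm at least [r]. *)
have [K0|/nonemptyPn K0] := pselect (K !=set0); last first.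
  apply: nearW => c z _; rewrite ltNge; apply/negP => /normK.
  by rewrite K0.
have cK : compact K.
  apply: bounded_closed_compact.
    exists r; split; first by rewrite num_real.
    by move=> x rx z /= ->; exact: ltW.
  apply: (@preimage_closed _ _ (fun z : 'rV[R]_p => `|z|) [set x | x = r]).
    by move=> z _; exact: norm_continuous.
  exact: closed_eq.
have [z0 + Kmin] := EVT_min_rV K0 cK (continuous_subspaceT (convex_continuous g cg)).
rewrite inE => Kz0.
have gz0 : 0 < g z0 by apply: gp; rewrite -normr_gt0 Kz0.
near=> c => z gzc; rewrite ltNge; apply/negP => rz.
have zp : 0 < `|z| by exact: lt_le_trans rz.
have := Kmin _ (mem_set (normK z rz)).
apply/negP; rewrite -ltNge.
have l0 : 0 <= r / `|z| by rewrite divr_ge0// ltW.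
have l1 : r / `|z| <= 1 by rewrite ler_pdivrMr// mul1r.
apply: le_lt_trans (convex_scale_le g z _ cg g0 l0 l1) _.
have cz0 : c < g z0 by near: c; exact: nbhs_right_lt.
have c0 : 0 < c by near: c; exact: nbhs_right_gt.
apply: le_lt_trans (_ : _ <= r / `|z| * c) _; first exact: ler_wpM2l.
apply: le_lt_trans cz0; rewrite ler_piMl//; exact: ltW.
Unshelve. all: by end_near. Qed.

(** * Steering to the origin in [d] steps *)

(** The Kalman matrix [M] has a right inverse, so the stacked inputs can cancel [A ^+ d *m x]. Gains
    linear in [x] keep utility and consumption convex or concave in the initial state. *)
Lemma deadbeat_control {R : realType} {d m : nat} (A : 'M[R]_d) (B : 'M[R]_(d, m)) :
  controllable A B ->
  exists (K : nat -> 'M[R]_(m, d)) (L : nat -> 'M[R]_d),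
    (forall x t, traj A B x (fun t => K t *m x) t = L t *m x) /\
    (forall t, (d <= t)%N -> K t = 0 /\ L t = 0).
Proof.
move=> cAB.
set M := \mxrow_(k < d) (A ^+ k *m B).
have MV : M *m pinvmx M = 1%:M by apply: mulmxVp; rewrite /row_free cAB.
pose W := - (pinvmx M *m A ^+ d).
(* Block [k] of [W] is the feedback gain at time [d - 1 - k]. *)
pose K t := if (insub (d.-1 - t)%N : option 'I_d) is Some k then
  (if (t < d)%N then submxcol W k else 0) else 0 : 'M[R]_(m, d).
pose fix L t := if t is t'.+1 then A *m L t' + B *m K t' else 1%:M : 'M[R]_d.
have KL x t : traj A B x (fun t => K t *m x) t = L t *m x.
  by elim: t => [|t IH] /=; rewrite ?mul1mx// IH mulmxDl !mulmxA.
(* Discrete variation of constants. *)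
have Lsum t : L t = A ^+ t + \sum_(s < t) A ^+ (t.-1 - s) *m B *m K s.
  elim: t => [|t IH]; first by rewrite big_ord0 addr0.
  rewrite /= IH mulmxDr -[A *m A ^+ t]/(A * A ^+ t) -exprS -addrA; congr (_ + _).
  rewrite big_ord_recr /= subnn expr0 mul1mx; congr (_ + _).
  rewrite mulmx_sumr; apply: eq_bigr => s _.
  rewrite !mulmxA -[A *m A ^+ _]/(A * A ^+ _) -exprS; congr (_ ^+ _ *m _ *m _).
  have := ltn_ord s; case: (t) s => [[]//|t'] s /= st; by rewrite subSn.
have Ld : L d = 0.
  (* Reversing time lines up the powers of [A] with the column blocks of [M]. *)
  rewrite Lsum (reindex_inj rev_ord_inj) /=.
  have -> : \sum_(s < d) A ^+ (d.-1 - (d - s.+1)) *m B *m K (d - s.+1)%N =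
      \sum_(k < d) (A ^+ k *m B) *m submxcol W k.
    apply: eq_bigr => s _; have sd := ltn_ord s.
    have e : (d.-1 - (d - s.+1) = s)%N by lia.
    have td : (d - s.+1 < d)%N by rewrite ltn_subrL (leq_ltn_trans _ sd).
    by rewrite /K e valK td.
  rewrite -(mul_mxrow_mxcol (fun k : 'I_d => A ^+ k *m B) (fun k => submxcol W k)).
  by rewrite submxcolK /W mulmxN mulmxA MV mul1mx subrr.
(* The test [t < d] in [K] matters: for [d > 0], truncated subtraction sends every later [t] to the
   valid block 0. *)
have K0 t : (d <= t)%N -> K t = 0.
  by move=> dt; rewrite /K ltnNge dt /=; case: insub.
exists K, L; split => // t dt; split; first exact: K0.
rewrite -(subnK dt); elim: (t - d)%N => [//|k IH] /=.
by rewrite IH K0 ?leq_addl// !mulmx0 addr0.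
Qed.

(** * Series of nonpositive terms *)

Lemma npeseries_le_term {R : realType} (F : nat -> \bar R) (t : nat) :
  (forall k, F k <= 0)%E -> (\sum_(k <oo) F k <= F t)%E.
Proof.
move=> F0; apply: lime_le; first exact: is_cvg_npeseries.
near=> k.
have tk : (t < k)%N by near: k; exact: nbhs_infty_gt.
rewrite big_mkord (bigD1 (Ordinal tk)) //=.
by apply: geeDl; apply: sume_le0.
Unshelve. all: by end_near. Qed.

(** At most [d] terms are nonzero; dividing by [d.+1] instead of [d] avoids a zero divisor. *)
Lemma npeseries_finite_horizon_ge {R : realType} (F : nat -> R) (d : nat) (e : R) :
  0 <= e -> (forall k, F k <= 0) -> (forall k, (d <= k)%N -> F k = 0) ->
  (forall k, - (e / d.+1%:R) <= F k) -> ((- e)%:E <= \sum_(k <oo) (F k)%:E)%E.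
Proof.
move=> e0 Fle0 F0 Fge; apply: lime_ge.
  by apply: is_cvg_npeseries => k _ _; rewrite lee_fin.
near=> k.
have dk : (d <= k)%N by near: k; exact: nbhs_infty_ge.
rewrite (big_cat_nat _ dk)//= [X in (_ + X)%E]big1_seq; last first.
  by move=> j; rewrite mem_index_iota => /and3P[_ dj _]; rewrite F0.
rewrite adde0 big_mkord sumEFin lee_fin.
apply: le_trans (_ : \sum_(j < d) (- (e / d.+1%:R)) <= _); last exact: ler_sum.
rewrite sumr_const card_ord mulNrn lerN2 -[_ *+ d]mulr_natr mulrAC ler_pdivrMr ?ltr0n//.
by apply: ler_wpM2l => //; rewrite ler_nat.
Unshelve. all: by end_near. Qed.

(** * Utilities and consumption near the origin *)

Lemma negative_definite_le0 {R : realType} {d m : nat}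
    (f : 'cV[R]_d -> 'cV[R]_m -> R) (x : 'cV[R]_d) (u : 'cV[R]_m) :
  negative_definite f -> f x u <= 0.
Proof.
move=> [f0 fn]; have [[-> ->]|xu] := eqVneq (x, u) (0, 0); first by rewrite f0.
by apply/ltW/fn.
Qed.

Lemma linear_convex_comb {R : realType} {V W : lmodType R} (P : V -> W)
    (x y : V) (l : R) :
  linear P -> P (l *: x + (1 - l) *: y) = l *: P x + (1 - l) *: P y.
Proof.
move=> lP; have P0 : P 0 = 0.
  by have := lP (-1) 0 0; rewrite scaleN1r oppr0 addr0 scaleN1r addNr.
by rewrite lP -[_ *: y]addr0 lP P0 addr0.
Qed.

Lemma convex_fun_comp {R : realType} {m : nat} {V : lmodType R}
    (h : 'cV[R]_m -> R) (Q : V -> 'cV[R]_m) :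
  convex_fun h -> linear Q -> convex_lmod (fun v => h (Q v)).
Proof. by move=> ch lQ x y l l0 l1; rewrite (linear_convex_comb Q)//; exact: ch. Qed.

Lemma concave_fun_comp {R : realType} {d m : nat} {V : lmodType R}
    (f : 'cV[R]_d -> 'cV[R]_m -> R) (P : V -> 'cV[R]_d) (Q : V -> 'cV[R]_m) :
  concave_fun f -> linear P -> linear Q -> convex_lmod (fun v => - f (P v) (Q v)).
Proof.
move=> cf lP lQ x y l l0 l1.
by rewrite (linear_convex_comb P)// (linear_convex_comb Q)// !mulrN -opprD lerN2; exact: cf.
Qed.

(** Coercivity of [- f] in the pair [(x, u)] forces the pair near 0, where the convex [h] is small.
    Pairs are coded as row vectors to fit [convex_coercive]. *)
Lemma small_input_of_large_utility {R : realType} {d m : nat}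
    (f : 'cV[R]_d -> 'cV[R]_m -> R) (h : 'cV[R]_m -> R) (c : R) :
  concave_fun f -> negative_definite f -> convex_fun h -> h 0 = 0 -> 0 < c ->
  \forall e \near 0^'+, forall x u, - e <= f x u -> h u <= c.
Proof.
move=> cf nf ch h0 c0.
pose P (z : 'rV[R]_(d + m)) : 'cV[R]_d := (lsubmx z)^T.
pose Q (z : 'rV[R]_(d + m)) : 'cV[R]_m := (rsubmx z)^T.
have lP : linear P by move=> k x y; apply/colP => i; rewrite !mxE.
have lQ : linear Q by move=> k x y; apply/colP => i; rewrite !mxE.
have P0 : P 0 = 0 by apply/colP => i; rewrite !mxE.
have Q0 : Q 0 = 0 by apply/colP => i; rewrite !mxE.
have hQ0 : h (Q 0) = 0 by rewrite Q0.
have /nbhs_norm0P[/= r r0 hr] := convex_near0 _ c (convex_fun_comp h Q ch lQ) hQ0 c0.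
have g0 : - f (P 0) (Q 0) = 0 by rewrite P0 Q0 nf.1 oppr0.
have gp z : z != 0 -> 0 < - f (P z) (Q z).
  move=> z0; rewrite oppr_gt0; apply: nf.2; apply: contra z0 => /eqP[Pz Qz].
  rewrite -(hsubmxK z); move/(congr1 trmx): Pz; move/(congr1 trmx): Qz.
  by rewrite !trmxK !trmx0 => -> ->; rewrite row_mx0.
apply: filterS (convex_coercive _ r (concave_fun_comp f P Q cf lP lQ) g0 gp r0).
move=> e He x u fe.
have [Px Qu] : P (row_mx x^T u^T) = x /\ Q (row_mx x^T u^T) = u.
  by rewrite /P /Q row_mxKl row_mxKr !trmxK.
by rewrite -Qu; apply: hr; apply: He; rewrite Px Qu lerNl.
Qed.

(** Under deadbeat control each stage cost and consumption is a convex function of [x0] vanishing at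
    0. Only the times before [d] matter, so finitely many neighbourhoods are intersected. *)
Lemma small_steering {R : realType} {n d m : nat} (i : 'I_n)
    (A : 'M[R]_d) (B : 'M[R]_(d, m)) (f : 'cV[R]_d -> 'cV[R]_m -> R)
    (h : 'cV[R]_m -> R) (e c : R) :
  controllable A B -> concave_fun f -> negative_definite f -> convex_fun h ->
  h 0 = 0 -> 0 < e -> 0 < c ->
  \forall x0 \near (0 : 'M[R]_(d, n)), exists u : nat -> 'cV[R]_m,
    ((- e)%:E <= \sum_(t <oo) (f (traj A B (col i x0) u t) (u t))%:E)%E /\
    forall t, h (u t) <= c.
Proof.
move=> cAB cf nf ch h0 e0 c0.
have [K [L [KL KL0]]] := deadbeat_control A B cAB.
have lin p (S : 'M[R]_(p, d)) : linear (fun x0 : 'M[R]_(d, n) => S *m col i x0).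
  by move=> k x y; rewrite linearP /= mulmxDr scalemxAr.
have S0 p (S : 'M[R]_(p, d)) : S *m col i (0 : 'M[R]_(d, n)) = 0.
  by rewrite linear0 mulmx0.
have ed : 0 < e / d.+1%:R by rewrite divr_gt0 ?ltr0n.
have Hf (t : 'I_d) : \forall x0 \near (0 : 'M[R]_(d, n)),
    - f (L t *m col i x0) (K t *m col i x0) <= e / d.+1%:R.
  apply: convex_near0 ed; first exact: (concave_fun_comp f _ _ cf (lin _ _) (lin _ _)).
  by rewrite !S0 nf.1 oppr0.
have Hh (t : 'I_d) : \forall x0 \near (0 : 'M[R]_(d, n)), h (K t *m col i x0) <= c.
  apply: convex_near0 c0; first exact: (convex_fun_comp h _ ch (lin _ _)).
  by rewrite S0.
apply: filterS2 (filter_forall _ Hf) (filter_forall _ Hh) => x0 fx0 hx0.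
exists (fun t => K t *m col i x0); split.
  under eq_eseriesr do rewrite KL.
  apply: (npeseries_finite_horizon_ge _ d) => [|k|k dk|k].
  - exact: ltW.
  - exact: negative_definite_le0.
  - by have [-> ->] := KL0 k dk; rewrite !mul0mx nf.1.
  - have [dk|kd] := leqP d k.
      by have [-> ->] := KL0 k dk; rewrite !mul0mx nf.1 oppr_le0 ltW.
    by rewrite lerNl; exact: (fx0 (Ordinal kd)).
move=> t; have [dt|td] := leqP d t.
  by have [-> _] := KL0 t dt; rewrite mul0mx h0 ltW.
exact: (hx0 (Ordinal td)).
Qed.

(** * Trades and equilibrium at zero price *)

(** Each agent gives up an equal share [S t] of the total surplus, which balances the trades. *)
Lemma sw_admissible_of_budget {R : realType} {n m : nat} (h : 'I_n -> 'cV[R]_m -> R)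
    (a : 'I_n -> nat -> R) (U : 'I_n -> nat -> 'cV[R]_m) :
  (forall t, \sum_(i < n) h i (U i t) <= \sum_(i < n) a i t) ->
  exists E, sw_admissible h a U E.
Proof.
move=> hU.
pose S t := (\sum_(i < n) a i t - \sum_(i < n) h i (U i t)) / n%:R.
exists (fun i t => a i t - h i (U i t) - S t); split => [i|] t.
  by rewrite gerBl divr_ge0 ?ler0n// subr_ge0.
rewrite !sumrB sumr_const card_ord -[S t *+ n]mulr_natr.
case: n h a U hU @S => [|n] h a U hU S; first by rewrite !big_ord0 mulr0 !subr0.
by rewrite /S divfK ?subrr// pnatr_eq0.
Qed.

Theorem theorem7 (R : realType) (n d m : nat)
  (A : 'I_n -> 'M[R]_d) (B : 'I_n -> 'M[R]_(d, m))
  (f : 'I_n -> 'cV[R]_d -> 'cV[R]_m -> R) (h : 'I_n -> 'cV[R]_m -> R)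
  (a : 'I_n -> nat -> R) :
  assumptionB f h a ->
  (forall i, controllable (A i) (B i)) ->
  exists X0 : set 'M[R]_(d, n),
    X0 `<=` feasible_initial_conditions A B f h a /\
    interior X0 !=set0 /\ (interior X0) 0 /\
    (forall x0, X0 x0 ->
       forall U E, sw_optimal A B f h a x0 U E ->
         competitive_equilibrium A B f h a x0 (fun _ => 0) U E).
Proof.
move=> [Hf [Hh [h0 [C [C0 aC]]]]] cAB.
(* The [n] agents, each consuming at most [c], stay within [C]; [n.+1] also covers [n = 0]. *)
pose c := C / n.+1%:R.
have c0 : 0 < c by rewrite divr_gt0 ?ltr0n.
have budget U : (forall i t, h i (U i t) <= c) -> exists E, sw_admissible h a U E.
  move=> hU; apply: sw_admissible_of_budget => t; apply: le_trans (aC t).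
  apply: le_trans (_ : \sum_(i < n) c <= _); first exact: ler_sum.
  rewrite sumr_const card_ord -[_ *+ n]mulr_natr /c mulrAC ler_pdivrMr ?ltr0n//.
  by apply: ler_wpM2l; rewrite ?ler_nat// ltW.
have fle0 i x u : f i x u <= 0 by apply: negative_definite_le0; exact: (Hf i).2.
pose V i (x0 : 'M[R]_(d, n)) u :=
  (\sum_(t <oo) (f i (traj (A i) (B i) (xi0 x0 i) u t) (u t))%:E)%E.
have Vle0 i x0 u : (V i x0 u <= 0)%E.
  by apply: npeseries_le0 => t _ _; rewrite lee_fin.
have [e [e0 fh]] : exists e : R, 0 < e /\
    forall i x u, - e <= f i x u -> h i u <= c.
  have near_e (i : 'I_n) : \forall e \near 0^'+, forall x u, - e <= f i x u -> h i u <= c.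
    have [[cf nf] [_ ch]] := (Hf i, Hh i).
    exact: small_input_of_large_utility.
  have /filter_ex[e [? ?]] : \forall e \near (0 : R)^'+, 0 < e /\
      forall i x u, - e <= f i x u -> h i u <= c.
    apply: filterS2 (nbhs_right_gt 0) (filter_forall _ near_e); split => //.
  by exists e.
have Vh i x0 u : ((- e)%:E <= V i x0 u)%E -> forall t, h i (u t) <= c.
  move=> eV t; apply: (fh i (traj (A i) (B i) (xi0 x0 i) u t)).
  rewrite -lee_fin; apply: le_trans eV _.
  by apply: npeseries_le_term => k; rewrite lee_fin.
(* Each agent may lose [e'], so that the total loss is at most [e]. *)
pose e' := e / n.+1%:R.
have e'0 : 0 < e' by rewrite divr_gt0 ?ltr0n.
pose steerable i : set 'M[R]_(d, n) := [set x0 | exists u,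
  ((- e')%:E <= V i x0 u)%E /\ forall t, h i (u t) <= c].
pose X0 : set 'M[R]_(d, n) := [set x0 | forall i, steerable i x0].
have X0_0 : (interior X0) 0.
  apply: (@filter_forall _ _ steerable (nbhs (0 : 'M[R]_(d, n)))) => i.
  have [[cf nf] [_ ch]] := (Hf i, Hh i).
  exact: (small_steering i (A i) (B i) (f i) (h i) e' c).
have X0_steer x0 : X0 x0 -> exists U E, sw_admissible h a U E /\
    ((- e)%:E <= social_welfare A B f x0 U)%E.
  move=> /choice[U HU].
  have [E UE] := budget U (fun i => (HU i).2).
  exists U, E; split => //.
  apply: le_trans (_ : (\sum_(i < n) (- e')%:E <= _)%E); last first.
    by apply: lee_sum => i _; exact: (HU i).1.
  rewrite sumEFin lee_fin sumr_const card_ord mulNrn lerN2 -[_ *+ n]mulr_natr mulrAC.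
  by rewrite ler_pdivrMr ?ltr0n//; apply: ler_wpM2l; rewrite ?ler_nat// ltW.
have sw_le0 x0 U : (social_welfare A B f x0 U <= 0)%E.
  by apply: sume_le0 => i _; exact: Vle0.
exists X0; split; last first.
  split; first by exists 0.
  split; first exact: X0_0.
  move=> x0 X0x0 U E [UE Uopt].
  have [U1 [E1 [UE1 eU1]]] := X0_steer x0 X0x0.
  have eU := le_trans eU1 (Uopt U1 E1 UE1).
  (* The other agents contribute nonpositive values, so each single value inherits the bound on the
     total. *)
  have eV i : ((- e)%:E <= V i x0 (U i))%E.
    apply: le_trans eU _; rewrite /social_welfare (bigD1 i)//=.
    by apply: geeDl; apply: sume_le0 => j _; exact: Vle0.
  have Vfin i : V i x0 (U i) \is a fin_num.
    rewrite fin_numElt (lt_le_trans (ltNyr (- e)) (eV i)).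
    exact: le_lt_trans (Vle0 _ _ _) (ltry 0).
  have value0 i u E' : agent_value A B f i x0 (fun=> 0) u E' = V i x0 u.
    by rewrite /agent_value; under eq_eseriesr do rewrite mul0r addr0.
  split; last exact: UE.2.
  move=> i; split; first exact: UE.1.
  split; first by rewrite value0.
  (* A better plan [u] also has value at least [- e], hence consumption at most [c]. Replacing [U i]
     by [u] therefore stays within the budget and raises welfare. *)
  move=> u E' _; rewrite !value0 leNgt; apply/negP => Vlt.
  have hu := Vh i x0 u (le_trans (eV i) (ltW Vlt)).
  pose U' j := if j == i then u else U j.
  have [E2 UE2] : exists E, sw_admissible h a U' E.
    apply: budget => j t; rewrite /U'; case: eqP => [-> //|_].
    exact: (Vh j x0 (U j) (eV j) t).
  have := Uopt U' E2 UE2; rewrite /social_welfare (bigD1 i)//= [leRHS](bigD1 i)//=.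
  rewrite (eq_bigr (fun j => V j x0 (U j))) => [|j /negbTE ji]; last by rewrite /U' ji.
  (* Cancelling the other agents' values requires them to be finite. *)
  rewrite leeD2rE; last by apply/sum_fin_numP => j _ _; exact: Vfin.
  by rewrite {1 2}/U' eqxx leNgt Vlt.
(* Feasibility on [X0]: the optimal welfare lies between [- e] and 0. *)
move=> x0 /X0_steer[U [E [UE eU]]]; split; first by exists U, E.
rewrite fin_numElt; apply/andP; split.
  apply: lt_le_trans (ltNyr (- e)) _; apply: le_trans eU _.
  by apply: ereal_sup_ubound; exists U => //; exists E.
apply: le_lt_trans (ltry 0); apply: ge_ereal_sup => _ [U' _ <-]; exact: sw_le0.
Qed.
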